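(* With $d$ denoting the Euclidean metric in $\mathbb{R}^n\times\mathbb{R}^n$, defining $$d_U(\{a,a'\},\{b,b'\})=\min\bigl(d((a,a'),(b,b')),\ d((a,a'),(b',b))\bigr)$$ gives a metric on $C(\mathbb{R}^n,2)$ which has linear geodesics between any two points.
   Context: $F(\mathbb{R}^n,2)=\{(a,a')\in\mathbb{R}^n\times\mathbb{R}^n:a\ne a'\}$. The unordered configuration space $C(\mathbb{R}^n,2)$ is the quotient of $F(\mathbb{R}^n,2)$ by the involution reversing the order of the two points; its points are sets $\{a,a'\}$ with $a\ne a'$ in $\mathbb{R}^n$. ''Geodesic'' always means minimal geodesic. A linear geodesic between two points of $C(\mathbb{R}^n,2)$ is a geodesic for $d_U$ which is the image in $C(\mathbb{R}^n,2)$ of a linear path $t\mapsto(1-t)(a,a')+t(b,b')$, $0\le t\le 1$, lying in $F(\mathbb{R}^n,2)$, where $(a,a')$ and $(b,b')$ are ordered representatives of the two points. *)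

(* Defs.v *)
From HB Require Import structures.
From mathcomp Require Import all_boot all_order all_algebra.
From mathcomp Require Import all_classical all_reals all_analysis.

Set Implicit Arguments.
Unset Strict Implicit.
Unset Printing Implicit Defensive.
Import Order.TTheory GRing.Theory Num.Theory numFieldNormedType.Exports.
Local Open Scope classical_set_scope.
Local Open Scope ring_scope.
Local Open Scope quotient_scope.

(* The library norm on ['rV[R]_n * 'rV[R]_n] is the sup norm, hence an explicit
   Euclidean distance. *)
Definition eucl_dist (R : realType) (n : nat) (p q : 'rV[R]_n * 'rV[R]_n) : R :=
  Num.sqrt (\sum_(i < n) (p.1 ord0 i - q.1 ord0 i) ^+ 2
            + \sum_(i < n) (p.2 ord0 i - q.2 ord0 i) ^+ 2).

Definition flip (T : Type) (p : T * T) : T * T := (p.2, p.1).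

(* As a type, [ordered_conf R n] carries the subspace topology. *)
Definition ordered_conf (R : realType) (n : nat) : set ('rV[R]_n * 'rV[R]_n) :=
  [set p | p.1 != p.2].
Arguments ordered_conf : clear implicits.

Definition flip_rel (R : realType) (n : nat) : rel (ordered_conf R n) :=
  fun p q => (\val q == \val p) || (\val q == flip (\val p)).

Lemma flip_rel_refl (R : realType) (n : nat) : reflexive (@flip_rel R n).
Proof. by move=> p; rewrite /flip_rel eqxx. Qed.

Lemma flip_rel_sym (R : realType) (n : nat) : symmetric (@flip_rel R n).
Proof.
move=> p q; rewrite /flip_rel eq_sym; congr (_ || _).
by apply/eqP/eqP => ->; rewrite /flip -surjective_pairing.
Qed.

Lemma flip_rel_trans (R : realType) (n : nat) : transitive (@flip_rel R n).
Proof.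
move=> q p r; rewrite /flip_rel => /orP[]/eqP -> /orP[]/eqP ->;
  by rewrite /flip -?surjective_pairing eqxx ?orbT.
Qed.

Canonical flip_equiv (R : realType) (n : nat) :=
  EquivRel (@flip_rel R n) (@flip_rel_refl R n) (@flip_rel_sym R n)
    (@flip_rel_trans R n).

Definition unordered_conf (R : realType) (n : nat) :=
  quotient_topology {eq_quot (flip_equiv R n)}.

Definition unord (R : realType) (n : nat) (p : ordered_conf R n) :
  unordered_conf R n := \pi_(unordered_conf R n) p.

Definition min_dist (R : realType) (n : nat) (p q : ordered_conf R n) : R :=
  Num.min (eucl_dist (\val p) (\val q)) (eucl_dist (\val p) (flip (\val q))).

(* [min_dist] on chosen representatives; independence of the choice is a claim
   to be proved about it. *)
Definition dU (R : realType) (n : nat) (x y : unordered_conf R n) : R :=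
  min_dist (repr x) (repr y).

Definition is_metric (R : realType) (T : Type) (d : T -> T -> R) : Prop :=
  [/\ forall x y, 0 <= d x y,
      forall x y, d x y = 0 <-> x = y,
      forall x y, d x y = d y x &
      forall x y z, d x z <= d x y + d y z].

Definition induces_topology (R : realType) (T : topologicalType)
    (d : T -> T -> R) : Prop :=
  forall U : set T, open U <->
    (forall x, U x -> exists2 e, 0 < e & [set y | d x y < e] `<=` U).

(* A minimal geodesic is parametrized on [0, 1] proportionally to arc length,
   so the constant [l] is [d x y]. The values of [g] off [0, 1] are junk. *)
Definition is_geodesic (R : realType) (T : topologicalType) (d : T -> T -> R)
    (x y : T) (g : R -> T) : Prop :=
  [/\ {within `[0, 1], continuous g}, g 0 = x, g 1 = y &
      exists l : R, forall s t : R, s \in `[0, 1] -> t \in `[0, 1] ->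
        d (g s) (g t) = l * `|s - t|].

Definition is_linear_geodesic (R : realType) (n : nat)
    (x y : unordered_conf R n) (g : R -> unordered_conf R n) : Prop :=
  is_geodesic (@dU R n) x y g /\
  exists p q : ordered_conf R n,
    [/\ unord p = x, unord q = y &
        forall t : R, t \in `[0, 1] -> exists2 r : ordered_conf R n,
          \val r = (1 - t) *: \val p + t *: \val q & g t = unord r].

(* Main.v *)
(* The flip is an isometry, so any lift [p] of [x] has a lift [q] of [y] with
   [d p q = dU x y]; the metric axioms and the topology follow from those of [d].
   For the geodesics, put [u = a - a'] and [v = b - b']. Expanding squares,
   [d ((a, a'), (b', b)) ^ 2 - d ((a, a'), (b, b')) ^ 2 = 2 <u, v>],
   so a minimizing pair of lifts has [<u, v> >= 0]. The difference of the two
   moving points along the segment is [(1 - t) u + t v]; it never vanishes, and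
   any two of its values have nonnegative inner product, so the points of the
   segment are again minimizing pairs of lifts. *)
Require Import Defs.
From HB Require Import structures.
From mathcomp Require Import all_boot all_order all_algebra.
From mathcomp Require Import all_classical all_reals all_analysis.
From mathcomp Require Import ring lra zify.

Set Implicit Arguments.
Unset Strict Implicit.
Unset Printing Implicit Defensive.
Import Order.TTheory GRing.Theory Num.Theory numFieldNormedType.Exports.
Local Open Scope classical_set_scope.
Local Open Scope ring_scope.


(** * Inner product and Euclidean distance on pairs of points *)

Section Euclidean.
Variables (R : realType) (n : nat).
Local Notation V := ('rV[R]_n * 'rV[R]_n)%type.
Implicit Types u v w p q r : V.

Definition dotp u v : R :=
  \sum_(i < n) u.1 ord0 i * v.1 ord0 i + \sum_(i < n) u.2 ord0 i * v.2 ord0 i.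

Lemma dotpC u v : dotp u v = dotp v u.
Proof. by congr (_ + _); apply: eq_bigr => i _; rewrite mulrC. Qed.

Lemma dotpDl u v w : dotp (u + v) w = dotp u w + dotp v w.
Proof.
rewrite /dotp [RHS]addrACA.
by congr (_ + _); rewrite -big_split; apply: eq_bigr => i _; rewrite mxE mulrDl.
Qed.

Lemma dotpZl a u v : dotp (a *: u) v = a * dotp u v.
Proof.
rewrite /dotp mulrDr !mulr_sumr.
by congr (_ + _); apply: eq_bigr => i _; rewrite mxE mulrA.
Qed.

Lemma dotpNl u v : dotp (- u) v = - dotp u v.
Proof. by rewrite -scaleN1r dotpZl mulN1r. Qed.

Lemma dotpDr u v w : dotp u (v + w) = dotp u v + dotp u w.
Proof. by rewrite dotpC dotpDl !(dotpC u). Qed.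

Lemma dotpZr a u v : dotp u (a *: v) = a * dotp u v.
Proof. by rewrite dotpC dotpZl dotpC. Qed.

Lemma dotpNr u v : dotp u (- v) = - dotp u v.
Proof. by rewrite dotpC dotpNl dotpC. Qed.

Definition dotp_linear := (dotpDl, dotpDr, dotpZl, dotpZr, dotpNl, dotpNr).

Lemma dotp_ge0 u : 0 <= dotp u u.
Proof. by apply: addr_ge0; apply: sumr_ge0 => i _; rewrite -expr2 sqr_ge0. Qed.

(** Serves both the definiteness of [dotp] and the comparison of Euclidean balls with sup-norm
    balls. *)
Lemma coord_sqr_le u i :
  u.1 ord0 i ^+ 2 <= dotp u u /\ u.2 ord0 i ^+ 2 <= dotp u u.
Proof.
have le_sum (x : 'rV[R]_n) : x ord0 i ^+ 2 <= \sum_(j < n) x ord0 j * x ord0 j.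
  rewrite (bigD1 i) //= -expr2 lerDl.
  by apply: sumr_ge0 => j _; rewrite -expr2 sqr_ge0.
have sum_ge0 (x : 'rV[R]_n) : 0 <= \sum_(j < n) x ord0 j * x ord0 j.
  by apply: sumr_ge0 => j _; rewrite -expr2 sqr_ge0.
by split; apply: le_trans (le_sum _) _; rewrite /dotp ?lerDl ?lerDr sum_ge0.
Qed.

Lemma dotp_eq0 u : dotp u u = 0 -> u = 0.
Proof.
move=> u0; case: u u0 => x y u0; congr pair; apply/rowP => i; rewrite mxE;
  have := coord_sqr_le (x, y) i;
  by rewrite u0 /= !real_exprn_even_le0 ?num_real //= => -[/eqP ? /eqP ?].
Qed.

(** The squared norm of [dotp v v *: u - dotp u v *: v] is [dotp v v] times the right side minus the
    left. *)
Lemma cauchy_schwarz u v : dotp u v ^+ 2 <= dotp u u * dotp v v.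
Proof.
have := dotp_ge0 (dotp v v *: u - dotp u v *: v).
rewrite !dotp_linear (dotpC v u).
have [v0 _|v0 h] := eqVneq (dotp v v) 0.
  (* Writing the zero vector as [0 *: 0] lets linearity kill every product with it. *)
  by rewrite (dotp_eq0 v0) -(scale0r 0) !dotp_linear !mul0r mulr0 expr2 mul0r.
have vpos : 0 < dotp v v by rewrite lt_def v0 dotp_ge0.
rewrite -subr_ge0 -(pmulr_rge0 _ vpos).
by lra.
Qed.

Lemma eucl_distE p q : eucl_dist p q = Num.sqrt (dotp (p - q) (p - q)).
Proof.
by congr (Num.sqrt (_ + _)); apply: eq_bigr => i _; rewrite !mxE expr2.
Qed.

Lemma eucl_dist_ge0 p q : 0 <= eucl_dist p q.
Proof. exact: sqrtr_ge0. Qed.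

Lemma sqr_eucl_dist p q : eucl_dist p q ^+ 2 = dotp (p - q) (p - q).
Proof. by rewrite eucl_distE sqr_sqrtr // dotp_ge0. Qed.

Lemma eucl_distC p q : eucl_dist p q = eucl_dist q p.
Proof. by rewrite !eucl_distE -opprB dotpNl dotpNr opprK. Qed.

Lemma eucl_dist0 p : eucl_dist p p = 0.
Proof. by rewrite eucl_distE subrr -(scale0r 0) dotpZl mul0r sqrtr0. Qed.

Lemma eucl_dist_eq0 p q : eucl_dist p q = 0 -> p = q.
Proof.
move=> d0; apply/subr0_eq/dotp_eq0.
by rewrite -sqr_eucl_dist d0 expr0n.
Qed.

(** After squaring, only the cross terms differ, and Cauchy-Schwarz compares them. *)
Lemma eucl_dist_triangle q p r :
  eucl_dist p r <= eucl_dist p q + eucl_dist q r.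
Proof.
have pq0 := eucl_dist_ge0 p q; have qr0 := eucl_dist_ge0 q r.
rewrite -(@ler_pXn2r _ 2) // ?nnegrE ?addr_ge0 ?eucl_dist_ge0 //.
have -> : eucl_dist p r ^+ 2 = eucl_dist p q ^+ 2 + eucl_dist q r ^+ 2
    + 2 * dotp (p - q) (q - r).
  have pr : p - r = (p - q) + (q - r) by rewrite subrKA.
  rewrite !sqr_eucl_dist pr; move: (p - q) (q - r) => u v.
  by rewrite !dotp_linear (dotpC v u); ring.
have := cauchy_schwarz (p - q) (q - r); rewrite -!sqr_eucl_dist -exprMn => cs.
have : dotp (p - q) (q - r) <= eucl_dist p q * eucl_dist q r.
  apply: le_trans (ler_norm _) _.
  by rewrite -(@ler_pXn2r _ 2) // ?nnegrE ?mulr_ge0 // real_normK ?num_real.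
by rewrite sqrrD -mulr_natl; lra.
Qed.

(** * The flip as a linear isometry *)

Lemma flipK p : flip (flip p) = p.
Proof. by case: p. Qed.

Lemma flipD p q : flip (p + q) = flip p + flip q.
Proof. by []. Qed.

Lemma flipZ a p : flip (a *: p) = a *: flip p.
Proof. by []. Qed.

Lemma dotp_flip u v : dotp (flip u) (flip v) = dotp u v.
Proof. exact: addrC. Qed.

Lemma dotp_flipl u v : dotp (flip u) v = dotp u (flip v).
Proof. by rewrite -dotp_flip flipK. Qed.

Lemma eucl_dist_flip p q : eucl_dist (flip p) (flip q) = eucl_dist p q.
Proof. by rewrite !eucl_distE -dotp_flip. Qed.

Lemma eucl_dist_flipl p q : eucl_dist (flip p) q = eucl_dist p (flip q).
Proof. by rewrite -eucl_dist_flip flipK. Qed.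

(** For [p = (a, a')], [p - flip p] is [(u, - u)] with [u = a - a'], so the product is [2 <u, v>]:
    exactly the difference of the squared distances. *)
Lemma eucl_dist_flip_le p q :
  (eucl_dist p q <= eucl_dist p (flip q)) =
  (0 <= dotp (p - flip p) (q - flip q)).
Proof.
rewrite -(@ler_pXn2r _ 2) // ?nnegrE ?eucl_dist_ge0 // -subr_ge0.
congr (0 <= _); rewrite !sqr_eucl_dist !dotp_linear !dotp_flip !dotp_flipl.
by rewrite (dotpC q (flip p)) dotp_flipl (dotpC q p); ring.
Qed.

Lemma sub_flip_eq0 p : (p - flip p == 0) = (p.1 == p.2).
Proof.
rewrite subr_eq0; case: p => x y; rewrite /flip /= xpair_eqE [y == x]eq_sym.
exact: andbb.
Qed.

(** * Linear paths *)

Definition lin_path p q (t : R) := (1 - t) *: p + t *: q.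

(** The map sending [p] to [p - flip p] is linear, so it carries segments to segments. *)
Lemma lin_path_flip p q t :
  lin_path p q t - flip (lin_path p q t) =
  lin_path (p - flip p) (q - flip q) t.
Proof. by rewrite /lin_path flipD !flipZ !scalerBr opprD addrACA. Qed.

Lemma eucl_dist_lin_path p q s t :
  eucl_dist (lin_path p q s) (lin_path p q t) = eucl_dist p q * `|s - t|.
Proof.
rewrite !eucl_distE.
have -> : lin_path p q s - lin_path p q t = (t - s) *: (p - q).
  by apply: injective_projections; apply/rowP => i; rewrite !mxE; ring.
rewrite dotpZl dotpZr mulrA -expr2 sqrtrM ?sqr_ge0 // sqrtr_sqr.
by rewrite mulrC distrC.
Qed.

Lemma dotp_lin_path_ge0 u v s t : 0 <= dotp u v ->
  s \in `[0, 1] -> t \in `[0, 1] -> 0 <= dotp (lin_path u v s) (lin_path u v t).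
Proof.
rewrite !in_itv /= => uv /andP[s0 s1] /andP[t0 t1].
have uu := dotp_ge0 u; have vv := dotp_ge0 v.
rewrite /lin_path !dotp_linear (dotpC v u).
(* With [1 - s] and [1 - t] as atoms, the expansion is a sum of products of nonnegative factors. *)
move: (1 - s) (1 - t) (subr_ge0 s 1) (subr_ge0 t 1) => s' t'.
rewrite s1 t1 => s'0 t'0.
by do ?[assumption | apply: addr_ge0 | apply: mulr_ge0].
Qed.

(* A segment between vectors at an angle at most pi / 2 avoids the origin. *)
Lemma lin_path_neq0 u v t : u != 0 -> v != 0 -> 0 <= dotp u v ->
  t \in `[0, 1] -> lin_path u v t != 0.
Proof.
move=> u0 v0 uv; rewrite in_itv /= => /andP[t0 t1]; apply/eqP => w0.
have posp w : w != 0 -> 0 < dotp w w.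
  move=> wn0; rewrite lt_def dotp_ge0 andbT.
  by apply: contra wn0 => /eqP/dotp_eq0 ->.
have : dotp (lin_path u v t) (lin_path u v t) = 0.
  by rewrite w0 -(scale0r 0) dotpZl mul0r.
rewrite /lin_path !dotp_linear (dotpC v u).
have uu := posp u u0; have vv := posp v v0.
(* At [t = 0] the squared norm is [dotp u u]; otherwise its [dotp v v] term is positive and the rest
   nonnegative. *)
have [->|tn0] := eqVneq t 0; first by lra.
have tp : 0 < t by rewrite lt_def tn0.
have : 0 < t * (t * dotp v v) by rewrite !mulr_gt0.
have : 0 <= t * ((1 - t) * dotp u v) by rewrite !mulr_ge0 // subr_ge0.
have : 0 <= (1 - t) * ((1 - t) * dotp u u).
  by rewrite !mulr_ge0 ?subr_ge0 // ltW.
by lra.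
Qed.

End Euclidean.

(** * Lifts of unordered configurations and the metric axioms *)

Section Configurations.
Variables (R : realType) (n : nat).
Implicit Types (p q : ordered_conf R n) (x y z : unordered_conf R n).

Lemma conf_neq p : (\val p).1 != (\val p).2.
Proof. exact: (set_mem (valP p)). Qed.

Definition mk_conf (v : 'rV[R]_n * 'rV[R]_n) (v12 : v.1 != v.2) :
  ordered_conf R n := exist _ v (mem_set v12).

Lemma conf_flip p : exists q, \val q = flip (\val p).
Proof.
have p21 : (flip (\val p)).1 != (flip (\val p)).2 by rewrite eq_sym conf_neq.
by exists (mk_conf p21).
Qed.

Lemma unord_eqP p q :
  unord p = unord q <-> \val q = \val p \/ \val q = flip (\val p).
Proof.
split.
  by move=> /(@eqmodP _ (flip_equiv R n)) /= /orP[]/eqP; [left|right].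
move=> pq; apply/(@eqmodP _ (flip_equiv R n)) => /=.
by apply/orP; case: pq => /eqP; [left|right].
Qed.

Lemma repr_unord p :
  \val (repr (unord p)) = \val p \/ \val (repr (unord p)) = flip (\val p).
Proof. by apply/unord_eqP; rewrite /unord reprK. Qed.

Lemma unord_repr x : unord (repr x) = x.
Proof. exact: reprK. Qed.

(** Changing a representative at most swaps the two arguments of the minimum. *)
Lemma dU_unord p q : dU (unord p) (unord q) = min_dist p q.
Proof.
rewrite /dU /min_dist.
have [-> | ->] := repr_unord p; have [-> | ->] := repr_unord q;
  by rewrite ?flipK ?eucl_dist_flip ?eucl_dist_flipl ?flipK // minC.
Qed.

Lemma dU_le p q : dU (unord p) (unord q) <= eucl_dist (\val p) (\val q).
Proof. by rewrite dU_unord ge_min lexx. Qed.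

Lemma dU_attained p y :
  exists2 q, unord q = y & dU (unord p) y = eucl_dist (\val p) (\val q).
Proof.
rewrite -(unord_repr y) dU_unord /min_dist; case: leP => _.
  by exists (repr y).
have [q qE] := conf_flip (repr y); exists q; last by rewrite qE.
by apply/unord_eqP; right; rewrite qE flipK.
Qed.

Lemma dU_xx x : dU x x = 0.
Proof.
by rewrite -(unord_repr x) dU_unord /min_dist eucl_dist0 min_l ?eucl_dist_ge0.
Qed.

Lemma dUC x y : dU x y = dU y x.
Proof.
have dUC_le x' y' : dU y' x' <= dU x' y'.
  rewrite -(unord_repr x'); have [q <- ->] := dU_attained (repr x') y'.
  by rewrite eucl_distC dU_le.
by apply/le_anti; rewrite !dUC_le.
Qed.

Lemma dU_is_metric : is_metric (@dU R n).
Proof.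
split=> [x y|x y|x y|x y z]; last 2 first.
- exact: dUC.
(* Lifts are chosen in succession: [q] nearest to [repr x], then [r] nearest to [q]. The pair
   [repr x], [r] need not be minimizing, but it bounds the left side. *)
- rewrite -(unord_repr x); have [q <- ->] := dU_attained (repr x) y.
  have [r <- ->] := dU_attained q z.
  by apply: le_trans (dU_le _ _) _; exact: eucl_dist_triangle.
- by rewrite le_min !eucl_dist_ge0.
- split=> [|->]; last exact: dU_xx.
  rewrite -(unord_repr x); have [q <- ->] := dU_attained (repr x) y.
  by move=> /eucl_dist_eq0 xq; apply/unord_eqP; left.
Qed.

(** * Comparison of topologies *)

Lemma ball_eucl_dist p q e : eucl_dist (\val p) (\val q) < e -> ball p e q.
Proof.
move=> pq_e; have e0 : 0 < e by apply: le_lt_trans pq_e; exact: eucl_dist_ge0.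
have coord (a : R) : a ^+ 2 <= eucl_dist (\val p) (\val q) ^+ 2 -> `|a| < e.
  move=> a2; apply: le_lt_trans pq_e.
  by rewrite -(@ler_pXn2r _ 2) // ?nnegrE ?eucl_dist_ge0 // real_normK ?num_real.
split; split=> // i j; rewrite ord1; apply: coord; rewrite sqr_eucl_dist.
  have [+ _] := coord_sqr_le (\val p - \val q) j.
  by rewrite !mxE.
have [_ +] := coord_sqr_le (\val p - \val q) j.
by rewrite !mxE.
Qed.

(* Each coordinate difference is below [e / (2 n + 1)], and there are [2 n]. *)
Lemma eucl_dist_ball p q e : 0 < e -> ball p (e / (n.*2.+1)%:R) q ->
  eucl_dist (\val p) (\val q) < e.
Proof.
move=> e0 [b1 b2]; set d := e / _ in b1 b2.
have N0 : 0 < n.*2.+1%:R :> R by rewrite ltr0n.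
have d0 : 0 < d by rewrite divr_gt0.
rewrite -(@ltr_pXn2r _ 2) // ?nnegrE ?eucl_dist_ge0 ?(ltW e0) //.
have sum_le (a b : 'rV[R]_n) : ball a d b ->
    \sum_(i < n) (a ord0 i - b ord0 i) ^+ 2 <= n%:R * d ^+ 2.
  move=> [_ ab]; rewrite mulr_natl -[n in X in _ <= X]card_ord -sumr_const.
  apply: ler_sum => i _; rewrite -real_normK ?num_real //.
  by rewrite ler_pXn2r ?nnegrE ?(ltW d0) // ltW //; exact: ab.
rewrite /eucl_dist sqr_sqrtr; last first.
  by rewrite addr_ge0 // sumr_ge0 // => i _; exact: sqr_ge0.
apply: le_lt_trans (lerD (sum_le _ _ b1) (sum_le _ _ b2)) _.
(* What remains is [2 n < (2 n + 1) ^ 2]; the extra 1 keeps the divisor nonzero at [n = 0]. *)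
have -> : e = n.*2.+1%:R * d by rewrite mulrC divfK ?gt_eqF.
rewrite -mulrDl -natrD addnn [ltRHS]exprMn ltr_pM2r ?exprn_gt0 //.
by rewrite -natrX ltr_nat expnS expn1; nia.
Qed.

Lemma dU_induces_topology : induces_topology (@dU R n).
Proof.
have openP (A : set (ordered_conf R n)) :
    open A <-> forall p, A p -> exists2 e, 0 < e & ball p e `<=` A.
  rewrite openE; split=> [oA p Ap|oA p Ap].
    by have /nbhs_ballP[e e0 be] := oA _ Ap; exists e.
  by apply/nbhs_ballP; have [e e0 be] := oA _ Ap; exists e.
(* Openness in the quotient is by definition openness of the preimage under [unord], to which
   [openP] applies. One direction lifts a nearby [y] to a nearby [q]; the other uses that [unord]
   does not increase distances. *)
move=> U; split=> [/openP oU x|oU].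
  rewrite -(unord_repr x) => /oU[e e0 eU]; exists e => // y /=.
  have [q <- ->] := dU_attained (repr x) y.
  by move=> /ball_eucl_dist; exact: eU.
apply/openP => p /oU[e e0 eU]; exists (e / n.*2.+1%:R).
  by rewrite divr_gt0 // ltr0n.
by move=> q /(eucl_dist_ball e0); move/(le_lt_trans (dU_le _ _)); exact: eU.
Qed.

(** * Linear geodesics *)

Lemma lin_path_conf p q t :
  eucl_dist (\val p) (\val q) <= eucl_dist (\val p) (flip (\val q)) ->
  t \in `[0, 1] -> exists r : ordered_conf R n,
    \val r = lin_path (\val p) (\val q) t.
Proof.
rewrite eucl_dist_flip_le => pq t01.
have r12 : (lin_path (\val p) (\val q) t).1 != (lin_path (\val p) (\val q) t).2.
  rewrite -sub_flip_eq0 lin_path_flip.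
  by apply: lin_path_neq0; rewrite // sub_flip_eq0 conf_neq.
by exists (mk_conf r12).
Qed.

Lemma dU_linear_geodesic x y : exists g, is_linear_geodesic x y g.
Proof.
rewrite -(unord_repr x); set p := repr x.
have [q <- pq] := dU_attained p y.
have min_pq : eucl_dist (\val p) (\val q) <= eucl_dist (\val p) (flip (\val q)).
  by rewrite -pq dU_unord ge_min lexx orbT.
(* [xget] makes the lift total in [t]; it can fall back on the default [p] only off [0, 1]. *)
pose lift t : ordered_conf R n :=
  xget p [set r | \val r = lin_path (\val p) (\val q) t].
have liftE t : t \in `[0, 1] -> \val (lift t) = lin_path (\val p) (\val q) t.
  by move=> /(lin_path_conf min_pq) r_ex; apply: xgetPex r_ex.
have lift_dist s t : s \in `[0, 1] -> t \in `[0, 1] ->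
    dU (unord (lift s)) (unord (lift t)) =
    eucl_dist (\val p) (\val q) * `|s - t|.
  move=> s01 t01; rewrite dU_unord /min_dist min_l.
    by rewrite !liftE // eucl_dist_lin_path.
  (* Two points of the segment again form a minimizing pair, since their difference vectors have
     nonnegative product. *)
  rewrite eucl_dist_flip_le !liftE // !lin_path_flip.
  by apply: dotp_lin_path_ge0; rewrite // -eucl_dist_flip_le.
have in0 : (0 : R) \in `[0, 1] by rewrite in_itv /= lexx ler01.
have in1 : (1 : R) \in `[0, 1] by rewrite in_itv /= lexx ler01.
exists (fun t => unord (lift t)); split; last first.
  exists p, q; split=> // t t01; exists (lift t) => //.
  exact: liftE.
split; last by exists (eucl_dist (\val p) (\val q)).
- apply/subspace_continuousP => s s01 U.
  rewrite nbhsE => -[W [oW Ws] WU].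
  have [e e0 eW] := (dU_induces_topology W).1 oW _ Ws.
  pose l := eucl_dist (\val p) (\val q).
  (* The path is [l]-Lipschitz; dividing by [l + 1] also covers [l = 0], when the endpoints
     coincide. *)
  have l0 : 0 < l + 1 by rewrite ltr_wpDl ?eucl_dist_ge0.
  apply/nbhs_ballP; exists (e / (l + 1)) => /=; first exact: divr_gt0.
  move=> t st t01; apply/WU/eW => /=.
  rewrite lift_dist // -/l.
  have : `|s - t| < e / (l + 1) by [].
  rewrite ltr_pdivlMr // => h; apply: le_lt_trans h.
  by rewrite mulrC ler_wpM2l // lerDl.
- apply/unord_eqP; left.
  by rewrite liftE // /lin_path subr0 scale1r scale0r addr0.
- apply/unord_eqP; left.
  by rewrite liftE // /lin_path subrr scale0r add0r scale1r.
Qed.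

End Configurations.

(** The first clause frees [dU] from the choice of representatives made by [repr]. *)
Theorem theorem1p7 (R : realType) (n : nat) :
  [/\ forall p q : ordered_conf R n,
        dU (unord p) (unord q) =
        Num.min (eucl_dist (\val p) (\val q)) (eucl_dist (\val p) (flip (\val q))),
      is_metric (@dU R n),
      induces_topology (@dU R n) &
      forall x y : unordered_conf R n,
        exists g : R -> unordered_conf R n, is_linear_geodesic x y g].
Proof.
split; [exact: dU_unord | exact: dU_is_metric | exact: dU_induces_topology |].
exact: dU_linear_geodesic.
Qed.
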